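(* Let $\omega=(\omega_1,\omega_2,\dots)$ be a non-constant infinite sequence with entries in $\{0,1,2\}$, and let $G=G_\omega$ be the associated Grigorchuk group acting on the binary rooted tree. Write $\sigma\omega=(\omega_2,\omega_3,\dots)$. Let $$N=\max\{i_0(\sigma\omega),\,i_1(\sigma\omega),\,i_2(\sigma\omega)\}+4$$ (so $N=\infty$ if some $i_k(\sigma\omega)=\infty$), and, if $i_k(\sigma\omega)=\infty$ for exactly one $k\in\{0,1,2\}$, let $$\widetilde N=\max\{i_j(\sigma\omega)\mid j\in\{0,1,2\},\ j\neq k\}+4 .$$ Set $$M=\begin{cases} N & \text{if } N \text{ is finite},\\ \widetilde N & \text{if } N \text{ is infinite and } \sigma\omega \text{ is not a constant sequence},\\ 4 & \text{if } \sigma\omega \text{ is a constant sequence}.\end{cases}$$ Then the quotient $G/\mathrm{St}_G(n)$ admits a ramification structure for all $n\ge M$.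
   Context: **Tree.** Let $\mathcal T$ be the binary rooted tree, whose vertices are identified with the finite words over $X=\{0,1\}$: the root is the empty word, and each word $\nu$ is joined to $\nu0$ and $\nu1$. Automorphisms of $\mathcal T$ fix the root and act on the right. The $n$th level consists of the words of length $n$. For $G\le\mathrm{Aut}(\mathcal T)$, $\mathrm{St}_G(n)$ is the (normal) subgroup of elements of $G$ fixing every vertex at level $n$. The natural isomorphism $\psi:\mathrm{St}_{\mathrm{Aut}(\mathcal T)}(1)\to \mathrm{Aut}(\mathcal T)\times\mathrm{Aut}(\mathcal T)$ sends an automorphism to its pair of restrictions to the subtrees rooted at the vertices $0$ and $1$ (each subtree identified with $\mathcal T$ by deleting the first letter). **Grigorchuk groups.** For an infinite sequence $\omega=(\omega_1,\omega_2,\dots)$ in $\{0,1,2\}$, put $\sigma\omega=(\omega_2,\omega_3,\dots)$. Let $a$ be the automorphism swapping the two maximal subtrees (i.e. changing the first letter of each nonempty word and nothing else), and let $e$ be the identity. Define $b_\omega,c_\omega,d_\omega\in\mathrm{St}_{\mathrm{Aut}(\mathcal T)}(1)$ recursively by $\psi(b_\omega)=(\beta,b_{\sigma\omega})$, $\psi(c_\omega)=(\gamma,c_{\sigma\omega})$, $\psi(d_\omega)=(\delta,d_{\sigma\omega})$, where $\beta=e$ if $\omega_1=2$ and $\beta=a$ otherwise; $\gamma=e$ if $\omega_1=1$ and $\gamma=a$ otherwise; $\delta=e$ if $\omega_1=0$ and $\delta=a$ otherwise. The Grigorchuk group is $G_\omega=\langle a,b_\omega,c_\omega,d_\omega\rangle$.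 **The numbers $i_k$.** For $k\in\{0,1,2\}$, $i_k(\omega)=\min\{n\in\mathbb N\mid \omega_n=k\}$ (with $\mathbb N=\{1,2,\dots\}$) if the minimum exists, and $i_k(\omega)=\infty$ otherwise; $i_k(\sigma\omega)$ is this quantity for the sequence $\sigma\omega$, with its entries indexed starting from $1$. **Ramification structures.** Let $H$ be a finite group. A (spherical) system of generators of $H$ is a tuple $T=(g_1,\dots,g_r)$, $r\ge3$, of non-trivial elements of $H$ with $\langle g_1,\dots,g_r\rangle=H$ and $g_1g_2\cdots g_r=e$. Put $\Sigma(T)=\bigcup_{g\in H}\bigcup_{i=1}^r\langle g_i\rangle^g$. Two tuples $T_1,T_2$ are disjoint if $\Sigma(T_1)\cap\Sigma(T_2)=\{e\}$. An (unmixed) ramification structure of size $(r_1,r_2)$ for $H$ is a pair $(T_1,T_2)$ of disjoint systems of generators of $H$ with $|T_1|=r_1$ and $|T_2|=r_2$. Here ''ramification structure'' without further qualification means one with $r_1=r_2$. *)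

(* Defs.v *)
From HB Require Import structures.
From mathcomp Require Import all_boot all_order all_algebra all_fingroup.
From mathcomp Require Import boolp classical_sets constructive_ereal.

Set Implicit Arguments.
Unset Strict Implicit.
Unset Printing Implicit Defensive.

Local Open Scope group_scope.
Local Open Scope classical_set_scope.

(* The letters 0 and 1 are [false] and [true]; the head of the list is the
   first letter, so the children of a vertex are obtained with [rcons]. *)
Notation vertex := (seq bool).

Definition adjacent (u v : vertex) : Prop :=
  exists x : bool, v = rcons u x \/ u = rcons v x.

Definition is_taut (f : vertex -> vertex) : Prop :=
  [/\ bijective f, f [::] = [::]
    & forall u v, adjacent (f u) (f v) <-> adjacent u v].

Record taut := Taut { taut_fun :> vertex -> vertex; tautP : is_taut taut_fun }.

HB.instance Definition _ := gen_eqMixin taut.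
HB.instance Definition _ := gen_choiceMixin taut.

Lemma taut_ext (f g : taut) : f =1 g -> f = g.
Proof.
case: f g => [f Hf] [g Hg] /= /funext fg; move: Hf Hg; rewrite fg => Hf Hg.
by congr Taut; apply: Prop_irrelevance.
Qed.

Lemma taut_one_subproof : is_taut id.
Proof. by split=> //; exists id. Qed.

Definition taut_one : taut := Taut taut_one_subproof.

Lemma taut_mul_subproof (f g : taut) : is_taut (fun v => g (f v)).
Proof.
case: f g => [f [bf f0 fa]] [g [bg g0 ga]] /=; split.
- exact: bij_comp.
- by rewrite f0.
- by move=> u v; rewrite ga.
Qed.

(* Automorphisms act on the right: the left factor of a product acts first. *)
Definition taut_mul (f g : taut) : taut := Taut (taut_mul_subproof f g).

Lemma taut_inv_ex (f : taut) :
  exists g : taut, cancel f g /\ cancel g f.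
Proof.
case: f => [f fP]; case: (fP) => -[g fK gK] f0 fa /=.
have gP : is_taut g.
  split; first by exists f.
  - by rewrite -f0 fK.
  - by move=> u v; rewrite -fa !gK.
by exists (Taut gP).
Qed.

Definition taut_inv (f : taut) : taut := projT1 (cid (taut_inv_ex f)).

Lemma taut_invP (f : taut) : cancel f (taut_inv f) /\ cancel (taut_inv f) f.
Proof. by rewrite /taut_inv; case: cid. Qed.

Lemma taut_mulA : associative taut_mul.
Proof. by move=> f g h; apply: taut_ext. Qed.

Lemma taut_mul1g : left_id taut_one taut_mul.
Proof. by move=> f; apply: taut_ext. Qed.

Lemma taut_mulg1 : right_id taut_one taut_mul.
Proof. by move=> f; apply: taut_ext. Qed.

Lemma taut_mulVg : left_inverse taut_one taut_inv taut_mul.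
Proof. by move=> f; apply: taut_ext => v; exact: (proj2 (taut_invP f)). Qed.

Lemma taut_mulgV : right_inverse taut_one taut_inv taut_mul.
Proof. by move=> f; apply: taut_ext => v; exact: (proj1 (taut_invP f)). Qed.

HB.instance Definition _ :=
  isGroup.Build taut taut_mulA taut_mul1g taut_mulg1 taut_mulVg taut_mulgV.

Lemma taut_mulE (f g : taut) v : (f * g) v = g (f v).
Proof. by []. Qed.

Lemma taut_oneE v : (1 : taut) v = v.
Proof. by []. Qed.

Lemma tautK (f : taut) : cancel f (f^-1 : taut).
Proof. exact: (proj1 (taut_invP f)). Qed.

Lemma tautVK (f : taut) : cancel (f^-1 : taut) f.
Proof. exact: (proj2 (taut_invP f)). Qed.

Lemma taut_rcons (f : taut) u x : exists y, f (rcons u x) = rcons (f u) y.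
Proof.
case: f => [f [bf f0 fa]] /=.
have adj w y : adjacent (f w) (f (rcons w y)) by apply/fa; exists y; left.
elim/last_ind: u x => [|u z IH] x.
  case: (adj [::] x) => y []; first by exists y.
  by rewrite f0 /= => /(congr1 size); rewrite size_rcons.
case: (adj (rcons u z) x) => y []; first by exists y.
have [y' ->] := IH z; move=> /rcons_inj [/(bij_inj bf) E _].
move: E => /(congr1 size); rewrite !size_rcons => /esym/eqP.
by rewrite gtn_eqF ?ltnS ?leqnSn.
Qed.

Lemma size_taut (f : taut) v : size (f v) = size v.
Proof.
elim/last_ind: v => [|v x IH]; first by case: f => f [_ /= -> _].
by have [y ->] := taut_rcons f v x; rewrite !size_rcons IH.
Qed.

Section Subgroups.
Variable A : groupType.

Definition is_subgroup (H : set A) : Prop :=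
  H 1 /\ forall x y, H x -> H y -> H (x * y^-1).

Record subgroup := Subgroup { sg_set :> A -> Prop; sgP : is_subgroup sg_set }.

Lemma generated_subproof (S : set A) : is_subgroup (smallest is_subgroup S).
Proof.
split=> [H [[H1 _] _] //|x y Hx Hy H HS].
by case: (HS) => -[_ HV] _; apply: HV; [apply: Hx | apply: Hy].
Qed.

Definition generated (S : set A) : subgroup := Subgroup (generated_subproof S).

Lemma sg1 (H : subgroup) : H 1.
Proof. by case: H => ? []. Qed.

Lemma sgV (H : subgroup) x : H x -> H x^-1.
Proof.
by case: H => H [H1 HV] /= Hx; rewrite -[x^-1]mul1g; apply: HV.
Qed.

Lemma sgM (H : subgroup) x y : H x -> H y -> H (x * y).
Proof.
move=> Hx Hy; rewrite -[y]invgK.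
by apply: (proj2 (sgP H)) => //; exact: sgV.
Qed.

End Subgroups.

Definition level_stab (G : subgroup taut) (n : nat) : set taut :=
  [set g | G g /\ forall v : vertex, size v = n -> g v = v].

Section LevelQuotient.
Variables (G : subgroup taut) (n : nat).

Local Notation K := (level_stab G n).

Definition level_coset (g : taut) : set taut := [set g * s | s in K].

Record level_quot := LevelQuot {
  quot_set :> set taut;
  quotP : exists g, G g /\ quot_set = level_coset g }.

Lemma level_quot_ext (C D : level_quot) : C = D :> set taut -> C = D.
Proof.
case: C D => [C HC] [D HD] /= CD; move: HC HD; rewrite CD => HC HD.
by congr LevelQuot; apply: Prop_irrelevance.
Qed.

Lemma level_cosetE g h : G g ->
  level_coset g h <-> G h /\ forall v, size v = n -> h v = g v.
Proof.
move=> Gg; split=> [[s [Gs fs] <-]|[Gh gh]].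
  split; first exact: sgM.
  by move=> v nv; rewrite taut_mulE fs // size_taut.
exists (g^-1 * h); last by rewrite mulKVg.
split=> [|v nv]; first by apply: sgM => //; exact: sgV.
rewrite taut_mulE gh ?tautVK //.
by rewrite size_taut.
Qed.

Lemma level_coset_eq g h : G g -> G h ->
  level_coset g = level_coset h <-> (forall v, size v = n -> g v = h v).
Proof.
move=> Gg Gh; split=> [E|gh].
  by have /(level_cosetE _ Gh)[] : level_coset h g
    by rewrite -E; apply/(level_cosetE _ Gg).
apply/seteqP; split=> k.
  by move=> /(level_cosetE _ Gg)[Gk kg]; apply/(level_cosetE _ Gh);
    split=> // v nv; rewrite kg ?gh.
by move=> /(level_cosetE _ Gh)[Gk kg]; apply/(level_cosetE _ Gg);
  split=> // v nv; rewrite kg ?gh.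
Qed.

Lemma level_quot_one_subproof : exists g, G g /\ K = level_coset g.
Proof.
exists 1; split; first exact: sg1.
apply/seteqP; split=> k.
  by move=> [Gk fk]; apply/level_cosetE; [exact: sg1|].
by move=> /(level_cosetE _ (sg1 G)).
Qed.

Definition level_quot_one : level_quot := LevelQuot level_quot_one_subproof.

Lemma level_coset_mul g h : G g -> G h ->
  [set x * y | x in level_coset g & y in level_coset h] = level_coset (g * h).
Proof.
move=> Gg Gh; have Ggh := sgM Gg Gh; apply/seteqP; split=> k.
  move=> [x /(level_cosetE _ Gg)[Gx xg] [y /(level_cosetE _ Gh)[Gy yh] <-]].
  apply/(level_cosetE _ Ggh); split; first exact: sgM.
  by move=> v nv; rewrite !taut_mulE xg // yh // size_taut.
move=> [s Ks <-]; exists g; first by apply/(level_cosetE _ Gg).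
by exists (h * s); [exists s | rewrite mulgA].
Qed.

Lemma level_coset_inv g : G g ->
  [set x^-1 | x in level_coset g] = level_coset g^-1.
Proof.
move=> Gg; have Ggi := sgV Gg.
have inv_in x y : G x -> G y -> (forall v, size v = n -> x v = y v) ->
    forall v, size v = n -> (x^-1 : taut) v = (y^-1 : taut) v.
  move=> Gx Gy xy v nv; apply: (can_inj (tautK x)).
  by rewrite tautVK xy ?tautVK ?size_taut.
apply/seteqP; split=> k.
  move=> [x /(level_cosetE _ Gg)[Gx xg] <-]; apply/(level_cosetE _ Ggi).
  by split; [exact: sgV | apply: inv_in].
move=> /(level_cosetE _ Ggi)[Gk kg]; exists k^-1; last by rewrite invgK.
apply/(level_cosetE _ Gg); split; first exact: sgV.
by rewrite -[g]invgK; apply: inv_in.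
Qed.

Lemma level_quot_mul_subproof (C D : level_quot) :
  exists g, G g /\ [set x * y | x in (C : set taut) & y in (D : set taut)]
                  = level_coset g.
Proof.
case: C D => [? [g [Gg ?]]] [? [h [Gh ?]]]; subst; exists (g * h).
by split; [exact: sgM | exact: level_coset_mul].
Qed.

Definition level_quot_mul (C D : level_quot) : level_quot :=
  LevelQuot (level_quot_mul_subproof C D).

Lemma level_quot_inv_subproof (C : level_quot) :
  exists g, G g /\ [set x^-1 | x in (C : set taut)] = level_coset g.
Proof.
case: C => [? [g [Gg ?]]]; subst; exists g^-1.
by split; [exact: sgV | exact: level_coset_inv].
Qed.

Definition level_quot_inv (C : level_quot) : level_quot :=
  LevelQuot (level_quot_inv_subproof C).

Lemma level_quot_mulA : associative level_quot_mul.
Proof.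
move=> [? [g [Gg ?]]] [? [h [Gh ?]]] [? [k [Gk ?]]]; subst; apply: level_quot_ext.
by rewrite /= !level_coset_mul ?mulgA //; apply: sgM.
Qed.

Lemma level_quot_one_coset : K = level_coset 1.
Proof.
apply/seteqP; split=> k; first by move=> Kk; exists k; rewrite ?mul1g.
by move=> [s Ks <-]; rewrite mul1g.
Qed.

Lemma level_quot_mul1g : left_id level_quot_one level_quot_mul.
Proof.
move=> [? [g [Gg ?]]]; subst; apply: level_quot_ext.
by rewrite /= level_quot_one_coset level_coset_mul ?mul1g //; apply: sg1.
Qed.

Lemma level_quot_mulVg :
  left_inverse level_quot_one level_quot_inv level_quot_mul.
Proof.
move=> [? [g [Gg ?]]]; subst; apply: level_quot_ext => /=.
rewrite level_coset_inv // level_coset_mul ?mulVg ?level_quot_one_coset //.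
exact: sgV.
Qed.

(* [G / K] is finite: a coset is determined by its action on level [n]. *)
Lemma level_quot_act_subproof (C : level_quot) (t : n.-tuple bool) :
  size (projT1 (cid (quotP C)) t) == n.
Proof. by rewrite size_taut size_tuple. Qed.

Definition level_quot_act (C : level_quot) : {ffun n.-tuple bool -> n.-tuple bool} :=
  [ffun t => Tuple (level_quot_act_subproof C t)].

Lemma level_quot_act_inj : injective level_quot_act.
Proof.
move=> C D /ffunP CD; apply: level_quot_ext.
have {CD} : forall v, size v = n ->
    projT1 (cid (quotP C)) v = projT1 (cid (quotP D)) v.
  move=> v /eqP nv; have /(congr1 val) := CD (Tuple nv).
  by rewrite !ffunE.
case: cid => g [Gg Cg]; case: cid => h [Gh Dh] /= gh.
by rewrite Cg Dh; apply/level_coset_eq.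
Qed.

Definition level_quot_unact (a : {ffun n.-tuple bool -> n.-tuple bool}) :
    option level_quot :=
  if pselect (exists C, level_quot_act C = a) is left ex
  then Some (projT1 (cid ex)) else None.

Lemma level_quot_actK : pcancel level_quot_act level_quot_unact.
Proof.
move=> C; rewrite /level_quot_unact; case: pselect => [ex|[]]; last by exists C.
by case: cid => D /= /level_quot_act_inj ->.
Qed.

End LevelQuotient.

HB.instance Definition _ G n :=
  Finite.copy (level_quot G n) (pcan_type (@level_quot_actK G n)).

HB.instance Definition _ G n := Finite_isGroup.Build (level_quot G n)
  (@level_quot_mulA G n) (@level_quot_mul1g G n) (@level_quot_mulVg G n).

Lemma adjacent_cons x y u v :
  adjacent (x :: u) (y :: v) <-> x = y /\ adjacent u v.
Proof.
split=> [[z []]|[-> [z []->]]]; rewrite -?rcons_cons.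
- by case=> -> ->; split=> //; exists z; left.
- by case=> -> ->; split=> //; exists z; right.
- by exists z; left.
- by exists z; right.
Qed.

Lemma adjacent_nil_cons x v : adjacent [::] (x :: v) <-> v = [::].
Proof.
split=> [[z [] []]|->]; last by exists x; left.
  by [].
by move/(congr1 size); rewrite /= size_rcons.
Qed.

Lemma adjacentC u v : adjacent u v <-> adjacent v u.
Proof. by split=> -[x [] ->]; exists x; [right|left|right|left]. Qed.

Lemma taut_nil (f : taut) v : f v = [::] <-> v = [::].
Proof.
split=> [fv|->]; last by apply/nilP; rewrite /nilp size_taut.
by apply/nilP; rewrite /nilp -(size_taut f) fv.
Qed.

Lemma grig_a_subproof :
  is_taut (fun v => if v is x :: w then ~~ x :: w else [::]).
Proof.
split=> //.
  by exists (fun v => if v is x :: w then ~~ x :: w else [::]);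
    case=> [|x v] //; rewrite negbK.
case=> [|x u] [|y v] //.
- by rewrite !adjacent_nil_cons.
- by rewrite adjacentC [X in _ <-> X]adjacentC !adjacent_nil_cons.
- rewrite !adjacent_cons; split=> -[xy uv]; split=> //; last by rewrite xy.
  exact: negb_inj xy.
Qed.

Definition grig_a : taut := Taut grig_a_subproof.

Lemma psi_inv_subproof (p : taut * taut) :
  is_taut (fun v => if v is x :: w then x :: (if x then p.2 else p.1) w
                    else [::]).
Proof.
split=> //.
  exists (fun v => if v is x :: w
                   then x :: (if x then p.2^-1 else p.1^-1 : taut) w else [::]);
  by case=> [|[] v] //; rewrite ?tautK ?tautVK.
case=> [|x u] [|y v] //.
- by rewrite !adjacent_nil_cons taut_nil.
- by rewrite adjacentC [X in _ <-> X]adjacentC !adjacent_nil_cons taut_nil.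
- rewrite !adjacent_cons; split=> -[xy uv]; split=> //; subst y.
    by case: (if x then _ else _) uv => f [bf f0 fa] /= /fa.
  by case: (if x then _ else _) => f [bf f0 fa] /=; apply/fa.
Qed.

(* The inverse of psi : St(1) -> Aut(T) x Aut(T); the letter 0, to which the
   first component belongs, is [false]. *)
Definition psi_inv (p : taut * taut) : taut := Taut (psi_inv_subproof p).

(* Sequences are indexed from 0 here: the entry omega_n, n >= 1, is
   [w n.-1]. *)
Definition shift (w : nat -> 'I_3) : nat -> 'I_3 := fun n => w n.+1.

Definition is_constant (w : nat -> 'I_3) : Prop := exists k, forall n, w n = k.

Definition k0 : 'I_3 := @Ordinal 3 0 isT.
Definition k1 : 'I_3 := @Ordinal 3 1 isT.
Definition k2 : 'I_3 := @Ordinal 3 2 isT.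

(* The action on vertices of the generators b, c, d, for k = 2, 1, 0
   respectively; the first component is trivial when omega_1 = k.  The
   recursion through psi that defines them is lemma [spinalE]. *)
Fixpoint spinal_fun (k : 'I_3) (w : nat -> 'I_3) (v : vertex) : vertex :=
  match v with
  | [::] => [::]
  | false :: u => false :: (if w 0%N == k then 1 else grig_a) u
  | true :: u => true :: spinal_fun k (shift w) u
  end.

Lemma spinal_subproof k w : is_taut (spinal_fun k w).
Proof.
have invK (b : bool) : involutive (if b then 1 else grig_a : taut).
  by case: b => // -[|x v] //=; rewrite negbK.
have nilE w' v : spinal_fun k w' v = [::] <-> v = [::] by case: v => [|[]].
split=> //.
  have K v : spinal_fun k w (spinal_fun k w v) = v.
    elim: v w => [|[] v IH] w //; first by rewrite /= IH.
    by congr (_ :: _); exact: invK.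
  by exists (spinal_fun k w).
move=> u; elim: u w => [|x u IH] w [|y v] //.
- by case: y; rewrite /= !adjacent_nil_cons ?nilE ?taut_nil.
- rewrite adjacentC [X in _ <-> X]adjacentC.
  by case: x; rewrite /= !adjacent_nil_cons ?nilE ?taut_nil.
- case: x y => [] []; rewrite /= !adjacent_cons ?IH //; try by split=> -[].
  by case: (if _ then _ else _) => f [bf f0 fa] /=; rewrite fa.
Qed.

Definition spinal k w : taut := Taut (spinal_subproof k w).

Lemma spinalE k w :
  spinal k w = psi_inv (if w 0%N == k then 1 else grig_a, spinal k (shift w)).
Proof. by apply: taut_ext => -[|[] v]. Qed.

Definition grig_b w := spinal k2 w.
Definition grig_c w := spinal k1 w.
Definition grig_d w := spinal k0 w.

Definition grigorchuk (w : nat -> 'I_3) : subgroup taut :=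
  generated [set g | [\/ g = grig_a, g = grig_b w, g = grig_c w | g = grig_d w]].

Section Bound.
Local Open Scope ereal_scope.

(* The index is shifted by one because sequences are indexed from 0. *)
Definition first_index (k : 'I_3) (w : nat -> 'I_3) : \bar int :=
  if pselect (exists n, w n == k) is left ex then (Posz (ex_minn ex).+1)%:E
  else +oo.

Definition bound_N (w : nat -> 'I_3) : \bar int :=
  maxe (maxe (first_index k0 (shift w)) (first_index k1 (shift w)))
       (first_index k2 (shift w)) + (Posz 4)%:E.

(* The value +oo when there is not exactly one [k] with infinite index is a
   dummy, which is never used by [bound_M]. *)
Definition bound_Ntilde (w : nat -> 'I_3) : \bar int :=
  if [pick k | [forall j, (first_index j (shift w) == +oo) == (j == k)]] is Some k
  then \big[maxe/-oo]_(j | j != k) first_index j (shift w) + (Posz 4)%:E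
  else +oo.

Definition bound_M (w : nat -> 'I_3) : \bar int :=
  if bound_N w < +oo then bound_N w
  else if `[< is_constant (shift w) >] then (Posz 4)%:E
  else bound_Ntilde w.

End Bound.

Section Ramification.
Variables (gT : finGroupType) (H : {group gT}).

Definition system_of_generators r (T : r.-tuple gT) : Prop :=
  [/\ (3 <= r)%N, forall i, tnth T i != 1, <<[set x in T]>>%g = H
    & (\prod_(i < r) tnth T i)%g = 1].

Definition Sigma r (T : r.-tuple gT) : {set gT} :=
  (\bigcup_(g in H) \bigcup_(i < r) <[tnth T i]> :^ g)%SET.

Definition ramification_structure r1 r2 (T1 : r1.-tuple gT) (T2 : r2.-tuple gT) :=
  [/\ system_of_generators T1, system_of_generators T2
    & Sigma T1 :&: Sigma T2 = 1%g].

Definition has_ramification_structure : Prop :=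
  exists r (T1 T2 : r.-tuple gT), ramification_structure T1 T2.

End Ramification.

(* Main.v *)
Require Import Defs.
From mathcomp Require Import all_boot all_order all_algebra all_fingroup.
From mathcomp Require Import boolp classical_sets constructive_ereal.

(** The argument reads everything off the abelianization of the finite group
    Q = G / St_G(n).  Call a map chi : Q -> bool with
    chi (x y) = chi x (+) chi y a character.  Suppose that the characters of Q
    separate a, b, c, d enough to show that Q / [Q, Q] is elementary abelian of
    order 8 with basis a, b, c.  Then the two generating triples

        a, b, c   and   ab, ac, ad

    have no common power up to conjugacy.  Indeed a, b, c are involutions, so a
    nontrivial conjugate of a power in the first triple has the class of a, b
    or c in the abelianization, whereas a power in the second triple has the
    class of 1, ab, ac or ad = abc.  The second triple does generate, because
    ab (ac)^-1 ad = a (bcd) = a.  Replacing (x, y, z) by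
    (x, x^-1, y, y^-1, z, z^-1) makes the product trivial without changing the
    cyclic subgroups involved; see [ramification_of_characters].

    The characters come from the tree.  For an automorphism g and a vertex v,
    let label g v tell whether g exchanges the two children of v, seen from the
    children of g v.  The sum [parity k g] of the labels over level k is a
    character, since g permutes level k, and it depends only on the action of g
    on level k + 1.  The level 0 parity detects a and kills b, c, d.  On level
    j + 1, the generator a has no label, and each of b, c, d has at most one,
    at the vertex 1^j 0: it is present exactly when omega_(j+1) differs from
    2, 1 or 0 respectively.  Two positions where omega takes different values
    therefore leave none of b, c, d undetected ([grigorchuk_ramification]).

    So the only arithmetic input is that some entry of omega at a position at
    most n - 1 differs from omega_1, and the bound M on n provides one
    ([bound_M_witness]). *)

Set Implicit Arguments.
Unset Strict Implicit.
Unset Printing Implicit Defensive.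

(** * Ramification structures from characters of order two *)

Section Characters.
Local Open Scope group_scope.

Definition character (gT : groupType) (chi : gT -> bool) : Prop :=
  {morph chi : x y / x * y >-> x (+) y}.

Section CharacterTheory.
Variables (gT : groupType) (chi : gT -> bool) (chiM : character chi).

Lemma character1 : chi 1 = false.
Proof. by have := chiM 1 1; rewrite mulg1; case: (chi 1). Qed.

Lemma characterV x : chi x^-1 = chi x.
Proof.
have := chiM x x^-1; rewrite mulgV character1.
by case: (chi x); case: (chi _).
Qed.

Lemma characterX x i : chi (x ^+ i) = odd i && chi x.
Proof.
elim: i => [|i IH]; first by rewrite expg0 character1.
by rewrite expgS chiM IH /=; case: (odd i); case: (chi x).
Qed.

Lemma characterJ x y : chi (x ^ y) = chi x.
Proof.
by rewrite conjgE !chiM characterV; case: (chi x); case: (chi y).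
Qed.

Lemma character_neq1 x : chi x -> x != 1.
Proof. by apply: contraL => /eqP->; rewrite character1. Qed.

End CharacterTheory.

Variables (gT : finGroupType) (H : {group gT}).

(** Pairing each entry with its inverse turns any three generators into a tuple
    of product 1 that spans the same cyclic subgroups. *)
Definition doubled (x y z : gT) : 6.-tuple gT :=
  [tuple x; x^-1; y; y^-1; z; z^-1].

Lemma doubled_system x y z :
    x != 1 -> y != 1 -> z != 1 -> <<[set x; y; z]>> = H ->
  system_of_generators H (doubled x y z).
Proof.
move=> x1 y1 z1 genH; split=> //.
- move=> i; apply: (allP (_ : all (fun g => g != 1) (doubled x y z))).
    by rewrite /= !invg_eq1 x1 y1 z1.
  exact: mem_tnth.
- rewrite -genH; apply/eqP; rewrite finset.eqEsubset !gen_subG; apply/andP; split.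
    apply/fintype.subsetP=> g; rewrite !inE.
    have [gx gy gz] : [/\ x \in <<[set x; y; z]>>, y \in <<[set x; y; z]>>
        & z \in <<[set x; y; z]>>].
      by split; apply: mem_gen; rewrite !inE eqxx ?orbT.
    by do ![case/predU1P=> [->|]]; rewrite ?groupV // => /eqP->; rewrite groupV.
  apply/fintype.subsetP=> g; rewrite !inE -orbA => g_xyz.
  apply: mem_gen; rewrite !inE.
  by case/or3P: g_xyz => ->; rewrite ?orbT.
- by rewrite !big_ord_recl big_ord0 !(tnth_nth 1) /= mulg1 !mulKVg mulgV.
Qed.

Lemma Sigma_doubled x y z g : g \in Sigma H (doubled x y z) ->
  exists t h i, t \in [:: x; y; z] /\ g = (t ^+ i) ^ h.
Proof.
case/bigcupP=> h _ /bigcupP[i _ /imsetP[u + ->]].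
have [t txyz ->]: exists2 t, t \in [:: x; y; z]
    & <[tnth (doubled x y z) i]> = <[t]>.
  by case: i => [[|[|[|[|[|[|//]]]]]] ?]; rewrite (tnth_nth 1) /= ?cycleV;
    [exists x | exists x | exists y | exists y | exists z | exists z];
    rewrite ?inE ?eqxx ?orbT.
by case/cycleP=> j ->; exists t, h, j.
Qed.

Lemma Sigma1 r (T : r.-tuple gT) : (0 < r)%N -> 1 \in Sigma H T.
Proof.
move=> r0; apply/bigcupP; exists 1 => //; apply/bigcupP.
by exists (Ordinal r0) => //; rewrite group1.
Qed.

(** The structure is given by the triples a, b, c and ab, ac, ad, doubled.  Let
    t^j, with t among a, b, c, be conjugate to (as)^i, with s among b, c, d.
    If j is even then t^j = 1.  If j is odd, every character xi satisfies
    xi t = i (xi a + xi s); the character that sees only a then forces i to be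
    odd when t = a and even otherwise.  In the first case a character with
    xi a = 0 and xi s = 1 gives 0 = 1; in the second, a character that is
    nonzero on t does. *)
Lemma ramification_of_characters a (b c d : gT) :
    a ^+ 2 = 1 -> b ^+ 2 = 1 -> c ^+ 2 = 1 -> b * c * d = 1 ->
    <<[set a; b; c]>> = H ->
    (exists chi : gT -> bool, [/\ character chi, chi a, ~~ chi b & ~~ chi c]) ->
    (forall s : gT, s \in [:: b; c; d] ->
      exists chi : gT -> bool, [/\ character chi, ~~ chi a & chi s]) ->
  has_ramification_structure H.
Proof.
move=> a2 b2 c2 bcd genH [chi [chiM chia /negbTE chib /negbTE chic]] sep.
have chis s : s \in [:: b; c; d] -> chi s = false.
  have /(congr1 chi) := bcd; rewrite !chiM chib chic character1 //= => chid.
  by rewrite !inE => /or3P[] /eqP->.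
have as_neq1 s : s \in [:: b; c; d] -> a * s != 1.
  by move=> s_bcd; apply: (character_neq1 chiM); rewrite chiM chia chis.
have s_neq1 s : s \in [:: b; c; d] -> s != 1.
  by case/sep=> xi [xiM _]; apply: character_neq1.
have inv (x : gT) : x ^+ 2 = 1 -> x^-1 = x.
  by move=> x2; apply/eqP; rewrite eq_invg_mul -expg2 x2.
exists 6, (doubled a b c), (doubled (a * b) (a * c) (a * d)); split.
- apply: doubled_system => //; first exact: (character_neq1 chiM).
    by rewrite s_neq1 ?inE ?eqxx.
  by rewrite s_neq1 ?inE ?eqxx ?orbT.
- apply: doubled_system; rewrite ?as_neq1 ?inE ?eqxx ?orbT //.
  rewrite -genH; apply/eqP; rewrite finset.eqEsubset !gen_subG; apply/andP; split.
    have [ga gb gc] : [/\ a \in <<[set a; b; c]>>, b \in <<[set a; b; c]>>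
        & c \in <<[set a; b; c]>>].
      by split; apply: mem_gen; rewrite !inE eqxx ?orbT.
    have gd : d \in <<[set a; b; c]>>.
      have -> : d = (b * c)^-1 by apply/eqP; rewrite eq_sym eq_invg_mul bcd.
      by rewrite groupV groupM.
    apply/fintype.subsetP=> g; rewrite !inE -orbA.
    by case/or3P=> /eqP->; apply: groupM.
  set K := <<[set a * b; a * c; a * d]>>.
  have [gb gc gd] : [/\ a * b \in K, a * c \in K & a * d \in K].
    by split; apply: mem_gen; rewrite !inE eqxx ?orbT.
  have ga : a \in K.
    (* Since c is an involution, the product is a (bcd). *)
    have <- : a * b * (a * c)^-1 * (a * d) = a.
      by rewrite invMg (inv c) // !mulgA mulgKV -!mulgA [b * _]mulgA bcd mulg1.
    by apply: groupM => //; apply: groupM => //; rewrite groupV.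
  apply/fintype.subsetP=> g; rewrite !inE -orbA => /or3P[] /eqP-> //.
    by rewrite -(groupMl _ ga).
  by rewrite -(groupMl _ ga).
- apply/eqP; rewrite finset.eqEsubset; apply/andP; split; last first.
    by rewrite finset.sub1set inE !Sigma1.
  apply/fintype.subsetP=> g; rewrite !inE => /andP[].
  case/Sigma_doubled=> [t [h [j [t_abc gt]]]].
  case/Sigma_doubled=> [u [k [i [u_as gu]]]].
  have {u_as} [s s_bcd us] : exists2 s, s \in [:: b; c; d] & u = a * s.
    by move: u_as; rewrite !inE => /or3P[] /eqP->;
      [exists b | exists c | exists d]; rewrite ?inE ?eqxx ?orbT.
  have t2 : t ^+ 2 = 1 by move: t_abc; rewrite !inE => /or3P[] /eqP->.
  have [j_odd | j_even] := boolP (odd j); last first.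
    have -> : g = 1.
      by rewrite gt -(even_halfK j_even) -mul2n expgM t2 expg1n conj1g.
    by [].
  have eval xi : character xi -> xi t = odd i && (xi a (+) xi s).
    move=> xiM; have := congr1 xi gt; rewrite gu us.
    by rewrite !characterJ // !characterX // j_odd xiM.
  have := eval chi chiM; rewrite chia (chis s) //= andbT.
  have [xi [xiM /negbTE xia xis]] := sep s s_bcd.
  move: t_abc; rewrite inE => /predU1P[ta | t_bc].
    by have := eval xi xiM; rewrite ta xia xis chia andbT => <-.
  have t_bcd : t \in [:: b; c; d].
    by move: t_bc; rewrite !inE => /orP[] ->; rewrite ?orbT.
  have [rho [rhoM _ rhot]] := sep t t_bcd.
  have := eval rho rhoM; rewrite rhot (chis t t_bcd) => + i_even.
  by rewrite -i_even.
Qed.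

End Characters.

(** * Parities of the labels on a level of the tree *)

Section Parity.
Local Open Scope group_scope.

Definition label (g : taut) (v : vertex) : bool := last false (g (rcons v false)).

Lemma taut_inj (g : taut) : injective g.
Proof. exact: can_inj (tautK g). Qed.

(** An automorphism is determined by its labels: the label of v is what g adds
    to the last letter of the children of v. *)
Lemma taut_rconsE (g : taut) v x : g (rcons v x) = rcons (g v) (x (+) label g v).
Proof.
rewrite /label; have [y Ey] := taut_rcons g v false.
rewrite Ey last_rcons; case: x; last by rewrite Ey.
have [z Ez] := taut_rcons g v true; rewrite Ez; congr rcons.
have : z != y.
  apply/eqP=> zy; have : rcons v true = rcons v false.
    by apply: (@taut_inj g); rewrite Ez Ey zy.
  by move/rcons_inj.
by case: z y {Ey Ez} => [] [].
Qed.

Lemma labelM g h v : label (g * h) v = label g v (+) label h (g v).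
Proof. by rewrite {1}/label taut_mulE !taut_rconsE last_rcons. Qed.

Lemma level_act_subproof k (g : taut) (t : k.-tuple bool) : size (g t) == k.
Proof. by rewrite size_taut size_tuple. Qed.

Definition level_act k g (t : k.-tuple bool) : k.-tuple bool :=
  Tuple (level_act_subproof g t).

Lemma level_act_inj k g : injective (@level_act k g).
Proof. by move=> s t /(congr1 val) /= /taut_inj /val_inj. Qed.

Definition parity k (g : taut) : bool :=
  \big[addb/false]_(v : k.-tuple bool) label g v.

(** Labels form a cocycle, label (gh) v = label g v + label h (g v), and
    summing over a whole level removes the twist by g. *)
Lemma parityM k : character (parity k).
Proof.
move=> g h; rewrite [parity k h](reindex_inj (@level_act_inj k g)) -big_split.
by apply: eq_bigr => v _; rewrite labelM.
Qed.

Lemma agree_prefix (g h : taut) k n : k <= n ->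
    (forall v, size v = n -> g v = h v) -> forall v, size v = k -> g v = h v.
Proof.
elim: n => [|n IH]; first by rewrite leqn0 => /eqP->.
rewrite leq_eqVlt => /predU1P[-> //|kn] gh; apply: IH => // v nv.
have := gh (rcons v false); rewrite size_rcons nv => /(_ erefl).
by rewrite !taut_rconsE => /rcons_inj[].
Qed.

Lemma parity_agree (g h : taut) k n : k < n ->
  (forall v, size v = n -> g v = h v) -> parity k g = parity k h.
Proof.
move=> kn gh; apply: eq_bigr => v _; rewrite /label.
by rewrite (agree_prefix kn gh) // size_rcons size_tuple.
Qed.

Lemma label_a v : label grig_a v = (v == [::]).
Proof. by case: v => [|x v] //; rewrite /label /= last_rcons. Qed.

Lemma parity_a k : parity k grig_a = (k == 0).
Proof.
case: k => [|k].
  rewrite /parity (big_pred1 [tuple]) ?label_a // => t.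
  by rewrite (tuple0 t); apply/esym/eqP.
by apply: big1 => t _; rewrite label_a -size_eq0 size_tuple.
Qed.

(** The right-hand side says that v is the vertex 1^j 0 with omega_(j+1)
    different from k.  When v is empty, its size's predecessor is 0 and the
    vertex tested is 0 itself, so the equality fails, as it should. *)
Lemma label_spinal k w v : label (spinal k w) v =
  (v == rcons (nseq (size v).-1 true) false) && (w (size v).-1 != k).
Proof.
elim: v w => [|[] v IH] w; first by rewrite /label /=; case: eqP.
  have -> : label (spinal k w) (true :: v) = label (spinal k (shift w)) v.
    rewrite /label rcons_cons.
    have -> u : spinal k w (true :: u) = true :: spinal k (shift w) u by [].
    by rewrite taut_rconsE /= !last_rcons.
  by rewrite IH; case: v {IH}.
rewrite /label /=; case: v {IH} => [|x v] /=; first by case: eqP.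
by case: eqP => _; rewrite /= last_rcons.
Qed.

Lemma parity_spinal k w j : parity j.+1 (spinal k w) = (w j != k).
Proof.
pose t0 := [tuple of rcons (nseq j true) false].
rewrite /parity (bigD1 t0) //= big1 ?addbF => [|t].
  by rewrite label_spinal /= size_rcons size_nseq eqxx.
by rewrite -val_eqE label_spinal size_tuple /= => /negbTE->.
Qed.

Lemma parity0_spinal k w : parity 0 (spinal k w) = false.
Proof. by apply: big1 => t _; rewrite label_spinal (tuple0 t). Qed.

Lemma grig_a_sq : grig_a * grig_a = 1.
Proof. by apply: taut_ext => -[|x v] //; rewrite taut_mulE /= negbK. Qed.

Lemma spinal_sq k w : spinal k w * spinal k w = 1.
Proof.
apply: taut_ext => v; rewrite taut_mulE taut_oneE.
elim: v w => [|[] v IH] w //=; first by congr cons; apply: IH.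
case: eqP => // _; congr cons.
by have /(congr1 (fun f : taut => f v)) := grig_a_sq.
Qed.

(** At a vertex 1^j 0 exactly two of the three generators act, both by a, and
    they cancel. *)
Lemma spinal_prod w : spinal k2 w * spinal k1 w * spinal k0 w = 1.
Proof.
apply: taut_ext => v; rewrite !taut_mulE taut_oneE.
elim: v w => [|[] v IH] w //=; first by congr cons; apply: IH.
have aa : grig_a (grig_a v) = v
  by have /(congr1 (fun f : taut => f v)) := grig_a_sq.
by congr cons; case: (w 0) => [[|[|[|//]]] ?]; apply: aa.
Qed.

End Parity.

(** * Characters of the level quotients *)

Section Quotient.
Local Open Scope group_scope.
Variables (G : subgroup taut) (n : nat).

(** The proof of membership is an argument because G is a predicate on
    automorphisms and not a type; [proj_ext] makes the choice of it harmless. *)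
Definition proj g (Gg : G g) : level_quot G n :=
  LevelQuot (ex_intro _ g (conj Gg erefl)).

Lemma proj_ext g h (Gg : G g) (Gh : G h) : g = h -> proj Gg = proj Gh.
Proof. by move=> gh; apply: level_quot_ext; rewrite /= gh. Qed.

Lemma projM g h (Gg : G g) (Gh : G h) : proj Gg * proj Gh = proj (sgM Gg Gh).
Proof. by apply: level_quot_ext; rewrite /= level_coset_mul. Qed.

Lemma proj1 (G1 : G 1) : proj G1 = 1.
Proof. by apply: level_quot_ext; rewrite /= level_quot_one_coset. Qed.

Lemma projV g (Gg : G g) : (proj Gg)^-1 = proj (sgV Gg).
Proof. by apply: level_quot_ext; rewrite /= level_coset_inv. Qed.

Lemma proj_surj C : exists g (Gg : G g), C = proj Gg.
Proof.
by case: C => C [g [Gg Cg]]; exists g, Gg; apply: level_quot_ext.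
Qed.

(** The parity of a chosen representative; for k < n any other one gives the
    same value, by [quot_parity_proj]. *)
Definition quot_parity k (C : level_quot G n) : bool :=
  parity k (projT1 (cid (Defs.quotP C))).

Lemma quot_parity_proj k g (Gg : G g) : k < n ->
  quot_parity k (proj Gg) = parity k g.
Proof.
move=> kn; rewrite /quot_parity; case: cid => h [Gh] /= gh.
by apply: (parity_agree kn); apply/(level_coset_eq n Gh Gg).
Qed.

Lemma quot_parityM k : k < n -> character (quot_parity k).
Proof.
move=> kn C D; have [g [Gg ->]] := proj_surj C; have [h [Gh ->]] := proj_surj D.
by rewrite projM !quot_parity_proj // parityM.
Qed.

End Quotient.

(** * Ramification structures of the level quotients *)

Section Generation.
Local Open Scope group_scope.

Lemma quot_generated (S : set taut) n
    (K : {group level_quot (Defs.generated S) n}) :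
    (forall g (Gg : Defs.generated S g), S g -> proj n Gg \in K) ->
  K :=: [set: level_quot (Defs.generated S) n].
Proof.
move=> SK; apply/eqP; rewrite -finset.subTset; apply/fintype.subsetP=> C _.
have [g [Gg ->]] := proj_surj C.
pose P : set taut := fun g => exists Gg : Defs.generated S g, proj n Gg \in K.
have Psub : is_subgroup P.
  split; first by exists (sg1 _); rewrite proj1 group1.
  move=> x y [Gx Kx] [Gy Ky]; exists (sgM Gx (sgV Gy)).
  by rewrite -projM -projV groupM ?groupV.
have [] : P g.
  apply: Gg; split=> // x Sx.
  have Gx : Defs.generated S x by move=> Q [_]; apply.
  by exists Gx; apply: SK.
by move=> Gg'; rewrite (proj_ext _ Gg' Gg).
Qed.

(** Level 0 isolates a.  The generator spinal k w is detected at level 1 when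
    omega_1 is not k, and otherwise at level j + 1, where omega has an entry
    that differs from omega_1 = k. *)
Lemma grigorchuk_ramification (w : nat -> 'I_3) n j :
    w j != w 0 -> j.+1 < n ->
  has_ramification_structure [set: level_quot (grigorchuk w) n]%G.
Proof.
move=> wj jn; set G := grigorchuk w.
have n0 : 0 < n by apply: leq_trans jn.
have n1 : 1 < n by apply: leq_trans jn.
have gen g : [\/ g = grig_a, g = grig_b w, g = grig_c w | g = grig_d w] -> G g.
  by move=> Sg Q [_]; apply.
have Ga : G grig_a by apply: gen; constructor 1.
have Gb : G (spinal k2 w) by apply: gen; constructor 2.
have Gc : G (spinal k1 w) by apply: gen; constructor 3.
have Gd : G (spinal k0 w) by apply: gen; constructor 4.
have proj_sq g (Gg : G g) : g * g = 1 -> proj n Gg ^+ 2 = 1.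
  move=> g2; rewrite expg2 projM -(proj1 n (sg1 G)); exact: proj_ext.
have bcd : proj n Gb * proj n Gc * proj n Gd = 1.
  rewrite !projM -(proj1 n (sg1 G)); apply: proj_ext; exact: spinal_prod.
apply: (ramification_of_characters (proj_sq _ Ga grig_a_sq)
  (proj_sq _ Gb (spinal_sq _ _)) (proj_sq _ Gc (spinal_sq _ _)) bcd).
- apply: (quot_generated (K := <<_>>%G)) => g Gg Sg.
  set K := <<_>>%G.
  have [Ka Kb Kc] : [/\ proj n Ga \in K, proj n Gb \in K & proj n Gc \in K].
    by split; apply: mem_gen; rewrite !inE eqxx ?orbT.
  have Kd : proj n Gd \in K by rewrite -(groupMl _ (groupM Kb Kc)) bcd group1.
  by case: Sg => gE; [rewrite (proj_ext n Gg Ga gE) | rewrite (proj_ext n Gg Gb gE)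
    | rewrite (proj_ext n Gg Gc gE) | rewrite (proj_ext n Gg Gd gE)].
- exists (@quot_parity G n 0); split; first exact: quot_parityM.
  + by rewrite quot_parity_proj // parity_a.
  + by rewrite quot_parity_proj // parity0_spinal.
  + by rewrite quot_parity_proj // parity0_spinal.
- have sep k (Gk : G (spinal k w)) : exists chi : level_quot G n -> bool,
      [/\ character chi, ~~ chi (proj n Ga) & chi (proj n Gk)].
    have [wk | wk] := eqVneq (w 0) k.
      exists (@quot_parity G n j.+1); rewrite !quot_parity_proj //.
      by rewrite parity_a parity_spinal -wk; split=> //; apply: quot_parityM.
    exists (@quot_parity G n 1); rewrite !quot_parity_proj //.
    by rewrite parity_a parity_spinal; split=> //; apply: quot_parityM.
  by move=> s; rewrite !inE => /or3P[] /eqP->.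
Qed.

End Generation.

(** * Extracting a position from the bound *)

Section Bounds.
Import Order.TTheory.
Local Open Scope ereal_scope.

Lemma first_index_le k w (m n : nat) :
    first_index k w + (Posz m)%:E <= (Posz n)%:E ->
  exists i, w i = k /\ (i.+1 + m <= n)%N.
Proof.
rewrite /first_index; case: pselect => [ex|] //.
case: ex_minnP => i /eqP wi _; rewrite lee_fin => le.
by exists i.
Qed.

Lemma ord3_other (k l : 'I_3) : exists m : 'I_3, (m != k) && (m != l).
Proof.
by case: k l => [[|[|[|//]]] ?] [[|[|[|//]]] ?];
  first [exists k0; done | exists k1; done | exists k2; done].
Qed.

(** Unless the shifted sequence is constant, the bound dominates the index of
    first occurrence of some letter other than omega_1: any such letter when all
    three occur, and when exactly one letter k is missing, a letter different
    from both k and omega_1.  If the shifted sequence is constant, already its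
    first entry differs from omega_1. *)
Lemma bound_M_witness (w : nat -> 'I_3) (n : nat) : ~ is_constant w ->
  bound_M w <= (Posz n)%:E -> exists2 j, w j != w 0%N & (j.+1 < n)%N.
Proof.
move=> hw hn.
have wit k : k != w 0%N -> first_index k (shift w) + (Posz 4)%:E <= (Posz n)%:E ->
    exists2 j, w j != w 0%N & (j.+1 < n)%N.
  move=> kw /first_index_le[i [wi le]]; exists i.+1; first by rewrite -wi in kw.
  by apply: leq_trans le; rewrite !addnS addn0; do 2!apply: leqW.
move: hn; rewrite /bound_M; case: ifP => [_|_].
  have [k /andP[kw _]] := ord3_other (w 0%N) (w 0%N).
  move=> hn; apply: (wit k kw); apply: le_trans hn.
  rewrite /bound_N leeD2r // !le_max.
  have: k \in [:: k0; k1; k2] by case: k {kw} => [[|[|[|//]]] ?].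
  by rewrite !inE => /or3P[] /eqP->; rewrite lexx ?orbT.
case: asboolP => [[k wk]|_].
  rewrite lee_fin => n4; exists 1%N; last by apply: leq_trans n4.
  apply/negP=> /eqP w1; apply: hw; exists k; case=> [|i]; last exact: wk.
  by rewrite -w1; apply: wk.
rewrite /bound_Ntilde; case: pickP => [k _|_] //.
have [l /andP[lk lw]] := ord3_other k (w 0%N).
move=> hn; apply: (wit l lw); apply: le_trans hn; rewrite leeD2r //.
exact: le_bigmax_cond.
Qed.

End Bounds.

Theorem theorem1 (w : nat -> 'I_3) (hw : ~ is_constant w) (n : nat)
    (hn : (bound_M w <= (Posz n)%:E)%E) :
  has_ramification_structure [set: level_quot (grigorchuk w) n]%G.
Proof.
have [j wj jn] := bound_M_witness hw hn.
exact: grigorchuk_ramification wj jn.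
Qed.
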